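(* Suppose that $W_{\boldsymbol\lambda}$ is a conditionally positive definite (CPD) unilateral weighted shift with weights $\boldsymbol\lambda=\{\lambda_n\}_{n=0}^\infty$ and $\kappa\in\mathbb{N}$ is such that $$\lambda_\kappa=\lambda_{\kappa+1}=\lambda_{\kappa+2}=\lambda_{\kappa+3}\neq1.$$ Then $\lambda_0\leq\lambda_1=\lambda_n$ for all $n\in\mathbb{N}$ and $W_{\boldsymbol\lambda}$ is subnormal with the Berger measure $\mu$ given by $$\mu=(1-Z)\delta_0+Z\delta_{\lambda_1^2}\quad\text{with}\quad Z=\Big(\frac{\lambda_0}{\lambda_1}\Big)^2.$$
   Context: $\mathbb{N}=\{1,2,\dots\}$ and $\mathbb{R}_+=[0,\infty)$; $\delta_t$ is the Borel probability measure concentrated at $t$. A real sequence $\{\gamma_n\}_{n=0}^\infty$ is CPD if $\sum_{i,j=0}^k \gamma_{i+j}\alpha_i\bar\alpha_j\geq 0$ for every finite sequence $\alpha_0,\dots,\alpha_k\in\mathbb{C}$ with $\sum_{j=0}^k\alpha_j=0$. A bounded operator $T$ on a complex Hilbert space $\mathcal{H}$ is CPD if $\{\|T^nh\|^2\}_{n=0}^\infty$ is CPD for every $h\in\mathcal{H}$. For a bounded sequence $\boldsymbol\lambda=\{\lambda_n\}_{n=0}^\infty$ of positive reals, $W_{\boldsymbol\lambda}$ is the bounded operator on $\ell^2$ with $W_{\boldsymbol\lambda}e_n=\lambda_ne_{n+1}$ ($\{e_n\}$ the standard orthonormal basis); $\hat\lambda_0=1$ and $\hat\lambda_n=\lambda_0^2\cdots\lambda_{n-1}^2$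 for $n\geq1$. If $W_{\boldsymbol\lambda}$ is subnormal, its Berger measure is the unique Borel measure $\mu$ on $\mathbb{R}_+$ with $\hat\lambda_n=\int_{\mathbb{R}_+}x^n\,d\mu(x)$ for all integers $n\geq0$. *)

(* Defs.v *)
From HB Require Import structures.
From mathcomp Require Import all_boot all_order all_algebra.
From mathcomp Require Import all_classical all_reals all_analysis.
From mathcomp Require Import complex.
From mathcomp Require Import ring lra.

Set Implicit Arguments.
Unset Strict Implicit.
Unset Printing Implicit Defensive.

Import Order.TTheory GRing.Theory Num.Theory.
Import numFieldNormedType.Exports.

Local Open Scope classical_set_scope.
Local Open Scope ring_scope.

Notation normc := ComplexField.Normc.normc.

(* A complex Hilbert space: a complete normed space over R[i] whose norm is
   induced by an inner product, linear in the first argument. *)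
HB.mixin Record CompleteNormedModule_isHilbert (R : realType) V
    & CompleteNormedModule R[i] V := {
  hdot : {dot V for (@Num.conj R[i])} ;
  sqr_hnormE : forall x : V, `|x| ^+ 2 = hdot x x
}.

#[short(type="hilbertType")]
HB.structure Definition Hilbert (R : realType) :=
  {V of CompleteNormedModule R[i] V & CompleteNormedModule_isHilbert R V}.

Definition square_summable (R : realType) (f : nat -> R[i]) : Prop :=
  cvgn (series (fun n => normc (f n) ^+ 2)).

Definition ell2_pred (R : realType) : {pred nat -> R[i]} :=
  fun f => `[< square_summable f >].

Record ell2 (R : realType) := Ell2 {
  ell2_fun :> nat -> R[i] ;
  _ : ell2_fun \in @ell2_pred R }.

HB.instance Definition _ (R : realType) := [isSub for @ell2_fun R].
HB.instance Definition _ (R : realType) := [Choice of ell2 R by <:].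

Section square_summable.
Context {R : realType}.
Implicit Types (f g h : nat -> R[i]) (u v : nat -> R) (z w : R[i]).

Lemma sqr_normcE z : normc z ^+ 2 = complex.Re z ^+ 2 + complex.Im z ^+ 2.
Proof. by case: z => a b /=; rewrite sqr_sqrtr// addr_ge0 ?sqr_ge0. Qed.

Lemma normc_conjE z : z * Num.conj z = (normc z ^+ 2)%:C%C.
Proof.
rewrite sqr_normcE; case: z => a b.
by rewrite -[Num.conj _]/(a -i* b)%C; simpc; congr (_ +i* _)%C; ring.
Qed.

Lemma seriesE u n : series u n = \sum_(0 <= k < n) u k.
Proof. by []. Qed.

Lemma nneg_cvg_series u (M : R) : (forall n, 0 <= u n) ->
  (forall n, series u n <= M) -> cvgn (series u).
Proof.
move=> u0 uM; apply: nondecreasing_is_cvgn.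
  by apply/nondecreasing_seqP => n; rewrite seriesSr lerDl.
by exists M => _ [n _ <-].
Qed.

Lemma square_summableP f (M : R) :
  (forall n, series (fun n => normc (f n) ^+ 2) n <= M) -> square_summable f.
Proof. by apply: nneg_cvg_series => n; exact: sqr_ge0. Qed.

Lemma cvg_series_dominated u f g : square_summable f -> square_summable g ->
  (forall n, `|u n| <= normc (f n) ^+ 2 + normc (g n) ^+ 2) ->
  cvgn (series u).
Proof.
move=> sf sg ufg; apply: normed_cvg.
apply: (series_le_cvg _ _ ufg) => //.
- by move=> n; rewrite addr_ge0 ?sqr_ge0.
- exact: (is_cvg_seriesD sf sg).
Qed.

Lemma square_summable_linear (a : R[i]) f g :
  square_summable f -> square_summable g -> square_summable (a *: f + g).
Proof.
move=> sf sg; rewrite /square_summable.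
have cf := @is_cvg_seriesZ _ _ (2 * normc a ^+ 2) sf.
have cg := @is_cvg_seriesZ _ _ (2 : R) sg.
apply: (series_le_cvg _ _ _ (is_cvg_seriesD cf cg)) => n.
- exact: sqr_ge0.
- rewrite -[leRHS]/(2 * normc a ^+ 2 * normc (f n) ^+ 2 + 2 * normc (g n) ^+ 2).
  apply: addr_ge0; apply: (mulr_ge0 _ (sqr_ge0 _)) => //.
  exact: (mulr_ge0 _ (sqr_ge0 _)).
rewrite -[leRHS]/(2 * normc a ^+ 2 * normc (f n) ^+ 2 + 2 * normc (g n) ^+ 2).
rewrite -[(a *: f + g) n]/(a * f n + g n) !sqr_normcE.
case: a (f n) (g n) {cf} => [a1 a2] [f1 f2] [g1 g2] /=.
have := sqr_ge0 (a1 * f1 - a2 * f2 - g1).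
have := sqr_ge0 (a1 * f2 + a2 * f1 - g2).
nra.
Qed.

Lemma ell2_submod_closed : submod_closed (@ell2_pred R).
Proof.
split.
  apply/asboolP; apply: (@square_summableP _ 0) => n.
  rewrite seriesE big1// => i _.
  by rewrite -[X in normc X]/(0 : R[i]) ComplexField.Normc.normc0 expr0n.
move=> a f g /asboolP sf /asboolP sg; apply/asboolP.
exact: square_summable_linear.
Qed.

End square_summable.

HB.instance Definition _ (R : realType) :=
  GRing.isSubmodClosed.Build _ _ (@ell2_pred R) ell2_submod_closed.
HB.instance Definition _ (R : realType) :=
  [SubChoice_isSubLmodule of ell2 R by <:].

(* The sum of a complex series, taken componentwise. *)
Definition csum (R : realType) (u : nat -> R[i]) : R[i] :=
  (limn (series (fun n => complex.Re (u n))) +i* limn (series (fun n => complex.Im (u n))))%C.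

Definition ell2_dot (R : realType) (f g : ell2 R) : R[i] :=
  csum (fun n => f n * Num.conj (g n)).

Definition ell2_norm (R : realType) (f : ell2 R) : R[i] :=
  (Num.sqrt (limn (series (fun n => normc (f n) ^+ 2))))%:C%C.

Section ell2_dot.
Context {R : realType}.
Implicit Types (f g h : ell2 R).

Lemma ell2P f : square_summable f.
Proof. exact/asboolP/(valP f). Qed.
Arguments ell2P : clear implicits.

Lemma csumP (a : R[i]) (u v : nat -> R[i]) :
  cvgn (series (fun n => complex.Re (u n))) -> cvgn (series (fun n => complex.Im (u n))) ->
  cvgn (series (fun n => complex.Re (v n))) -> cvgn (series (fun n => complex.Im (v n))) ->
  csum (fun n => a * u n + v n) = a * csum u + csum v.
Proof.
move=> ru iu rv iv; case: a => a1 a2; rewrite /csum; simpc.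
have zr (b : R) := @is_cvg_seriesZ _ _ b ru.
have zi (b : R) := @is_cvg_seriesZ _ _ b iu.
congr (_ +i* _)%C.
  rewrite -[a1 * _](@lim_seriesZ _ _ a1 ru) -[a2 * _](@lim_seriesZ _ _ a2 iu).
  rewrite -lim_seriesB// -lim_seriesD//; last exact: is_cvg_seriesB.
  congr (limn (series _)); apply/funext => n /=.
  rewrite -[RHS]/(a1 * complex.Re (u n) - a2 * complex.Im (u n)
                  + complex.Re (v n)).
  by case: (u n) (v n) => [? ?] [? ?].
rewrite -[a1 * _](@lim_seriesZ _ _ a1 iu) -[a2 * _](@lim_seriesZ _ _ a2 ru).
rewrite -lim_seriesD// -lim_seriesD//; last exact: is_cvg_seriesD.
congr (limn (series _)); apply/funext => n /=.
rewrite -[RHS]/(a1 * complex.Im (u n) + a2 * complex.Re (u n)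
                + complex.Im (v n)).
by case: (u n) (v n) => [? ?] [? ?].
Qed.

Lemma ell2_dot_cvgRe f g :
  cvgn (series (fun n => complex.Re (f n * Num.conj (g n)) : R)).
Proof.
apply: (cvg_series_dominated (ell2P f) (ell2P g)) => n /=.
rewrite !sqr_normcE; case: (f n) (g n) => [a b] [c d].
rewrite -[Num.conj _]/(c -i* d)%C; simpc => /=; rewrite ler_norml.
have := sqr_ge0 (a - c); have := sqr_ge0 (b - d).
have := sqr_ge0 (a + c); have := sqr_ge0 (b + d).
by move=> *; apply/andP; split; nra.
Qed.

Lemma ell2_dot_cvgIm f g :
  cvgn (series (fun n => complex.Im (f n * Num.conj (g n)) : R)).
Proof.
apply: (cvg_series_dominated (ell2P f) (ell2P g)) => n /=.
rewrite !sqr_normcE; case: (f n) (g n) => [a b] [c d].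
rewrite -[Num.conj _]/(c -i* d)%C; simpc => /=; rewrite ler_norml.
have := sqr_ge0 (a - d); have := sqr_ge0 (b - c).
have := sqr_ge0 (a + d); have := sqr_ge0 (b + c).
by move=> *; apply/andP; split; nra.
Qed.

Arguments ell2_dot_cvgRe : clear implicits.
Arguments ell2_dot_cvgIm : clear implicits.

Lemma ell2_dot_linear g : scalar (@ell2_dot R ^~ g).
Proof.
move=> a f h; rewrite /ell2_dot -csumP.
- by congr csum; apply/funext => n; rewrite -[X in X * _]/(a * f n + h n) mulrDl mulrA.
- exact: ell2_dot_cvgRe.
- exact: ell2_dot_cvgIm.
- exact: ell2_dot_cvgRe.
- exact: ell2_dot_cvgIm.
Qed.

Lemma ell2_dotC f g : ell2_dot f g = Num.conj (ell2_dot g f).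
Proof.
rewrite -[RHS]/(limn _ -i* limn _)%C; congr (_ +i* _)%C.
  congr (limn (series _)); apply/funext => n /=.
  case: (f n) (g n) => [a b] [c d].
  by rewrite -[Num.conj _]/(c -i* d)%C -[Num.conj _]/(a -i* b)%C /=; ring.
rewrite -(lim_seriesN (ell2_dot_cvgIm g f)).
congr (limn (series _)); apply/funext => n.
rewrite -[RHS]/(- complex.Im (g n * Num.conj (f n))) /=.
case: (f n) (g n) => [a b] [c d].
by rewrite -[Num.conj _]/(c -i* d)%C -[Num.conj _]/(a -i* b)%C /=; ring.
Qed.

Lemma ell2_dot_linearr f : linear_for (Num.conj \; *%R) (@ell2_dot R f).
Proof.
move=> a g h; rewrite ell2_dotC ell2_dot_linear rmorphD rmorphM /=.
by rewrite -!ell2_dotC.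
Qed.

Lemma ell2_dotE f :
  ell2_dot f f = (limn (series (fun n => normc (f n) ^+ 2)))%:C%C.
Proof.
rewrite /ell2_dot; under eq_fun do rewrite normc_conjE.
congr (_ +i* _)%C.
rewrite (_ : series _ = fun=> 0) ?lim_cst//.
by apply/funext => n; rewrite seriesE big1.
Qed.

Lemma ell2_lim_ge f n :
  series (fun n => normc (f n) ^+ 2) n <= limn (series (fun n => normc (f n) ^+ 2)).
Proof.
apply: nondecreasing_cvgn_le; last exact: ell2P.
by apply/nondecreasing_seqP => k; rewrite seriesSr lerDl sqr_ge0.
Qed.

Lemma ell2_lim_ge0 f : 0 <= limn (series (fun n => normc (f n) ^+ 2)).
Proof. by apply: le_trans (ell2_lim_ge f 0); rewrite seriesE big_geq. Qed.

Lemma ell2_coord_le f n :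
  normc (f n) ^+ 2 <= limn (series (fun n => normc (f n) ^+ 2)).
Proof.
apply: le_trans (ell2_lim_ge f n.+1).
rewrite seriesSr lerDr seriesE; apply: sumr_ge0 => i _; exact: sqr_ge0.
Qed.

Lemma ell2_dot_gt0 f : f != 0 -> 0 < ell2_dot f f.
Proof.
move=> f0; rewrite ell2_dotE ltcR lt_def ell2_lim_ge0 andbT.
apply: contra f0 => /eqP l0; apply/eqP/val_inj/funext => n /=.
apply: ComplexField.Normc.eq0_normc; apply/eqP; rewrite -sqrf_eq0 eq_le sqr_ge0 andbT.
by rewrite -l0 ell2_coord_le.
Qed.

End ell2_dot.

Arguments ell2P {R} f.
Arguments ell2_dot_cvgRe {R} f g.
Arguments ell2_dot_cvgIm {R} f g.

HB.instance Definition _ (R : realType) :=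
  bilinear_isBilinear.Build R[i] (ell2 R) (ell2 R) R[i]
    (GRing.Scale.Law.clone _ _ ( *%R ) _)
    (GRing.Scale.Law.clone _ _ (Num.conj \; *%R ) _)
    (@ell2_dot R) (@ell2_dot_linear R, @ell2_dot_linearr R).

HB.instance Definition _ (R : realType) :=
  @isHermitianSesquilinear.Build R[i] (ell2 R) false Num.conj (@ell2_dot R)
    (fun f g => etrans (ell2_dotC f g) (esym (mul1r _))).
HB.instance Definition _ (R : realType) :=
  isDotProduct.Build R[i] (ell2 R) (@ell2_dot R) (@ell2_dot_gt0 R).

Section ell2_norm.
Context {R : realType}.
Implicit Types (f g h : ell2 R).

Let q f : R := limn (series (fun n => normc (f n) ^+ 2)).
Let b f g : R := complex.Re (ell2_dot f g).

Let qE f : q f = b f f.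
Proof. by rewrite /b ell2_dotE. Qed.

Let q_scaleD (t : R) f g :
  q (t%:C%C *: f + g) = t ^+ 2 * q f + 2 * t * b f g + q g.
Proof.
have tJ : Num.conj t%:C%C = t%:C%C :> R[i] by exact: conjc_real.
have L x y z : ell2_dot (t%:C%C *: x + y) z = t%:C%C * ell2_dot x z + ell2_dot y z.
  exact: ell2_dot_linear.
have L' x y z : ell2_dot x (t%:C%C *: y + z) = t%:C%C * ell2_dot x y + ell2_dot x z.
  rewrite ell2_dotC L rmorphD rmorphM (ell2_dotC x y) (ell2_dotC x z).
  by congr (_ * _ + _); exact: tJ.
rewrite qE /b L !L' (ell2_dotC g f) !ell2_dotE -/(q _) -/(q _).
case: (ell2_dot f g) => x y; rewrite -[Num.conj _]/(x -i* y)%C.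
by simpc => /=; ring.
Qed.

Let q_ge0 f : 0 <= q f. Proof. exact: ell2_lim_ge0. Qed.

Let b_le f g : b f g <= Num.sqrt (q f) * Num.sqrt (q g).
Proof.
rewrite -sqrtrM//; apply: le_trans (ler_norm _) _.
rewrite -sqrtr_sqr ler_sqrt ?mulr_ge0//.
have [q0|q0] := eqVneq (q f) 0.
  have H t : 0 <= 2 * t * b f g + q g.
    by have := q_ge0 (t%:C%C *: f + g); rewrite q_scaleD q0 mulr0 add0r.
  have [->|b0] := eqVneq (b f g) 0; first by rewrite expr0n/= mulr_ge0.
  have := H (- (q g + 1) / (2 * b f g)).
  rewrite (_ : 2 * _ * _ = - (q g + 1)); first by lra.
  by field.
have := q_ge0 ((- b f g / q f)%:C%C *: f + g); rewrite q_scaleD.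
rewrite (_ : _ + _ = (q f * q g - b f g ^+ 2) / q f); last by field.
by rewrite pmulr_lge0 ?invr_gt0 ?lt_def ?q0 ?q_ge0// subr_ge0.
Qed.

Lemma ell2_normD f g : ell2_norm (f + g) <= ell2_norm f + ell2_norm g.
Proof.
rewrite /ell2_norm -!/(q _) -rmorphD lecR.
have s0 : 0 <= Num.sqrt (q f) + Num.sqrt (q g) by rewrite addr_ge0.
rewrite -(ler_pXn2r (_ : 0 < 2)%N) ?nnegrE// sqr_sqrtr//.
have -> : q (f + g) = q f + 2 * b f g + q g.
  by rewrite -[f]scale1r (q_scaleD 1) scale1r; ring.
rewrite sqrrD !sqr_sqrtr// lerD2r lerD2l.
by have := b_le f g; lra.
Qed.

Lemma ell2_normZ (a : R[i]) f : ell2_norm (a *: f) = `|a| * ell2_norm f.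
Proof.
rewrite /ell2_norm -[`|a|]/((normc a)%:C%C) -rmorphM; congr (_%:C)%C.
have n0 : 0 <= normc a by case: a => ? ?; exact: sqrtr_ge0.
rewrite -[in RHS](ger0_norm n0) -sqrtr_sqr -sqrtrM ?sqr_ge0//.
congr Num.sqrt; rewrite -[RHS](@lim_seriesZ _ _ (normc a ^+ 2) (ell2P f)).
congr (limn (series _)); apply/funext => n.
by rewrite -[RHS]/(normc a ^+ 2 * normc (f n) ^+ 2)
  -[(a *: f) n]/(a * f n) ComplexField.Normc.normcM exprMn.
Qed.

Lemma ell2_norm_sqr f : ell2_norm f ^+ 2 = ell2_dot f f.
Proof. by rewrite /ell2_norm -rmorphXn sqr_sqrtr ?ell2_lim_ge0// ell2_dotE. Qed.

Lemma ell2_norm_eq0 f : ell2_norm f = 0 -> f = 0.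
Proof.
move=> f0; apply/eqP/negPn/negP => /ell2_dot_gt0.
by rewrite -ell2_norm_sqr f0 expr0n ltxx.
Qed.

End ell2_norm.

HB.instance Definition _ (R : realType) :=
  Lmodule_isNormed.Build R[i] (ell2 R) ell2_normD ell2_normZ ell2_norm_eq0.

Section ell2_complete.
Context {R : realType}.
Implicit Types (f g h : ell2 R).

Lemma ell2_normE f :
  `|f| = (Num.sqrt (limn (series (fun n => normc (f n) ^+ 2))))%:C%C.
Proof. by []. Qed.

Lemma ell2_normc_coord f n : (normc (f n))%:C%C <= `|f|.
Proof.
rewrite ell2_normE lecR.
have n0 : 0 <= normc (f n) by case: (f n) => ? ?; exact: sqrtr_ge0.
by rewrite -[leLHS](ger0_norm n0) -sqrtr_sqr ler_wsqrtr// ell2_coord_le.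
Qed.

Lemma ell2_norm_leP f (e : R) : 0 <= e ->
  `|f| <= e%:C%C <->
  forall N, series (fun n => normc (f n) ^+ 2) N <= e ^+ 2.
Proof.
move=> e0; rewrite ell2_normE lecR; split=> [fe N|fe].
  apply: le_trans (ell2_lim_ge f N) _.
  by rewrite -[leLHS]sqr_sqrtr ?ell2_lim_ge0// ler_pXn2r// nnegrE ?sqrtr_ge0.
rewrite -[leRHS](ger0_norm e0) -sqrtr_sqr ler_wsqrtr//.
by apply: limr_le; [exact: ell2P|near=> N; exact: fe].
Unshelve. all: by end_near. Qed.

Lemma ell2_completeP (F : set_system (ell2 R)) :
  ProperFilter F -> cauchy F -> cvg F.
Proof.
move=> FF Fc.
have {}Fc (e : R) : 0 < e -> \forall x & y \near F, `|x - y| < e%:C%C.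
  move=> e0; move/cauchy_ballP : Fc => /(_ e%:C%C).
  by rewrite ltcR => /(_ e0); rewrite -ball_normE.
pose re n f : R := complex.Re (f n); pose im n f : R := complex.Im (f n).
have coord (p : ell2 R -> R) n :
    (forall f g, `|p f - p g| <= normc ((f - g) n)) -> cvg (p @ F).
  move=> pn; apply: R_complete; apply/cauchy_ballP => e e0.
  rewrite near_map2; apply: filterS (Fc e e0) => -[x y] /= xy.
  rewrite -ball_normE /=; apply: le_lt_trans (pn _ _) _.
  by rewrite -ltcR; apply: le_lt_trans xy; exact: ell2_normc_coord.
have cre n : cvg (re n @ F).
  apply: (coord _ n) => f g; rewrite -[(f - g) n]/(f n - g n) /re.
  rewrite -sqrtr_sqr; case: (f n) (g n) => [a1 a2] [b1 b2] /=.
  by rewrite ler_wsqrtr// lerDl sqr_ge0.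
have cim n : cvg (im n @ F).
  apply: (coord _ n) => f g; rewrite -[(f - g) n]/(f n - g n) /im.
  rewrite -sqrtr_sqr; case: (f n) (g n) => [a1 a2] [b1 b2] /=.
  by rewrite ler_wsqrtr// lerDr sqr_ge0.
pose l n : R[i] := (lim (re n @ F) +i* lim (im n @ F))%C.
have lP (e : R) : 0 < e -> \forall x \near F,
    forall N, series (fun n => normc ((x : ell2 R) n - l n) ^+ 2) N <= e ^+ 2.
  move=> e0; apply: filterS (nearP_dep (Fc e e0)) => x xF N.
  pose s y := series (fun n => normc ((x - y) n) ^+ 2) N.
  have sE y : s y = \sum_(0 <= n < N) ((re n x - re n y) ^+ 2
                                       + (im n x - im n y) ^+ 2).
    by apply: eq_bigr => n _; rewrite sqr_normcE -[(x - y) n]/(x n - y n)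
      /re /im; case: (x n) (y n) => [? ?] [? ?].
  have sl : s @ F --> series (fun n => normc (x n - l n) ^+ 2) N.
    rewrite (_ : s = fun y => \sum_(0 <= n < N) ((re n x - re n y) ^+ 2
        + (im n x - im n y) ^+ 2)); last exact/funext.
    rewrite seriesE; apply: cvg_big => [|n _].
      exact: (@add_continuous R^o).
    rewrite sqr_normcE (_ : complex.Re _ = re n x - lim (re n @ F)); last first.
      by rewrite /l /re; case: (x n).
    rewrite (_ : complex.Im _ = im n x - lim (im n @ F)); last first.
      by rewrite /l /im; case: (x n).
    by apply: cvgD; apply: cvgM; apply: cvgB (cvg_cst _) _.
  apply: (cvgr_to_le sl); apply: filterS xF => y /ltW.
  by move/(ell2_norm_leP _ (ltW e0)) => /(_ N).
have lmem : l \in @ell2_pred R.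
  have /filter_ex[x xP] := lP 1 ltr01.
  have sxl : square_summable (fun n => x n - l n) by apply: square_summableP xP.
  apply/asboolP; have := @square_summable_linear _ (-1) _ _ sxl (ell2P x).
  congr square_summable; apply/funext => n.
  by rewrite -[LHS]/(-1 * (x n - l n) + x n); ring.
apply/cvg_ex; exists (Ell2 lmem); apply/cvgrPdist_le => e e0.
have [e1 e1E] : exists e1 : R, e = e1%:C%C.
  by exists (complex.Re e); rewrite RRe_real// gtr0_real.
move: e0; rewrite e1E ltcR => e10.
apply: filterS (lP e1 e10) => x xP; rewrite distrC.
exact/(ell2_norm_leP _ (ltW e10)).
Qed.

End ell2_complete.

HB.instance Definition _ (R : realType) :=
  Uniform_isComplete.Build (ell2 R) (@ell2_completeP R).
HB.instance Definition _ (R : realType) :=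
  CompleteNormedModule_isHilbert.Build R (ell2 R)
    (@ell2_norm_sqr R).

Section weighted_shift.
Context {R : realType} (lam : nat -> R).
Hypothesis lam_bnd : bounded_fun lam.

Definition wshift_fun (f : nat -> R[i]) (n : nat) : R[i] :=
  if n is m.+1 then (lam m)%:C%C * f m else 0.

Lemma wshift_bound : exists2 c : R, 0 <= c &
  forall (f : ell2 R) N, series (fun n => normc (wshift_fun f n) ^+ 2) N
    <= (c * Num.sqrt (limn (series (fun n => normc (f n) ^+ 2)))) ^+ 2.
Proof.
have [M M0 lamM] := ex_strict_bound_gt0 lam_bnd.
exists M => [|f N]; first exact: ltW.
rewrite exprMn sqr_sqrtr ?ell2_lim_ge0//.
case: N => [|N].
  by rewrite seriesE big_geq// mulr_ge0 ?sqr_ge0 ?ell2_lim_ge0.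
rewrite seriesE big_nat_recl// -[wshift_fun f 0]/(0 : R[i]).
rewrite ComplexField.Normc.normc0 expr0n add0r.
apply: le_trans (ler_wpM2l (sqr_ge0 M) (ell2_lim_ge f N)).
rewrite seriesE mulr_sumr; apply: ler_sum => n _.
rewrite -[wshift_fun f n.+1]/((lam n)%:C%C * f n).
rewrite ComplexField.Normc.normcM exprMn ler_wpM2r ?sqr_ge0//.
rewrite sqr_normcE /= expr0n addr0 -[leLHS]ger0_norm ?sqr_ge0// normrX.
by rewrite ler_pXn2r ?nnegrE ?(ltW M0)// ltW//; exact: (lamM n Logic.I).
Qed.

Lemma wshift_subproof (f : ell2 R) : wshift_fun f \in @ell2_pred R.
Proof.
have [c _ cP] := wshift_bound.
by apply/asboolP; apply: square_summableP (cP f).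
Qed.

(* W (f_0, f_1, f_2, ...) = (0, lam_0 f_0, lam_1 f_1, ...) *)
Definition wshift (f : ell2 R) : ell2 R := Ell2 (wshift_subproof f).

Lemma wshift_linear : linear wshift.
Proof.
move=> a f g; apply/val_inj/funext => -[|n] /=.
  by rewrite -[RHS]/(a * 0 + 0) mulr0 addr0.
rewrite -[RHS]/(a * ((lam n)%:C%C * f n) + (lam n)%:C%C * g n).
by rewrite -[X in _ * X]/(a * f n + g n); ring.
Qed.

HB.instance Definition _ :=
  GRing.isLinear.Build R[i] (ell2 R) (ell2 R) _ wshift wshift_linear.

End weighted_shift.

Section ell2_basis.
Context {R : realType}.

Lemma ell2_basis_subproof (n : nat) :
  (fun k => (k == n)%:R) \in @ell2_pred R.
Proof.
apply/asboolP; apply: (@square_summableP _ _ 1) => N; rewrite seriesE.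
have [nN|Nn] := ltnP n N; last first.
  rewrite big1_seq ?ler01// => k; rewrite mem_index_iota => /andP[_ kN].
  by rewrite (ltn_eqF (leq_trans kN Nn)) ComplexField.Normc.normc0 expr0n.
rewrite (bigD1_seq n) ?mem_index_iota ?iota_uniq//= eqxx.
rewrite ComplexField.Normc.normc1 expr1n big1 ?addr0// => k /negPf ->.
by rewrite ComplexField.Normc.normc0 expr0n.
Qed.

Definition ell2_basis (n : nat) : ell2 R := Ell2 (ell2_basis_subproof n).

Lemma wshift_basis (lam : nat -> R) (lam_bnd : bounded_fun lam) (n : nat) :
  wshift lam_bnd (ell2_basis n) = (lam n)%:C%C *: ell2_basis n.+1.
Proof.
apply/val_inj/funext => -[|k] /=; rewrite -[RHS]/((lam n)%:C%C * (_ == _)%:R).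
  by rewrite mulr0.
by rewrite eqSS; have [->//|_] := eqVneq k n; rewrite !mulr0.
Qed.

End ell2_basis.

Section operators.
Context {R : realType}.

Definition bounded_operator (H K : hilbertType R) (T : H -> K) : Prop :=
  exists c : R, forall x, `|T x| <= c%:C%C * `|x|.

Definition is_adjoint (H : hilbertType R) (T S : H -> H) : Prop :=
  forall x y, hdot (T x) y = hdot x (S y).

Definition normal_operator (H : hilbertType R) (N : {linear H -> H}) : Prop :=
  bounded_operator N /\
  exists S : {linear H -> H}, is_adjoint N S /\ forall x, S (N x) = N (S x).

(* H is identified with its image under the isometric embedding V. *)
Definition subnormal (H : hilbertType R) (T : {linear H -> H}) : Prop :=
  exists (K : hilbertType R) (V : {linear H -> K}) (N : {linear K -> K}),
    [/\ forall x y, hdot (V x) (V y) = hdot x y,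
        normal_operator N &
        forall x, N (V x) = V (T x)].

Definition cpd_sequence (gamma : nat -> R) : Prop :=
  forall (k : nat) (alpha : nat -> R[i]),
    \sum_(j < k.+1) alpha j = 0 ->
    0 <= \sum_(i < k.+1) \sum_(j < k.+1)
           (gamma (i + j)%N)%:C%C * alpha i * Num.conj (alpha j).

(* Norms are elements of R[i] in a normedModType over R[i]. *)
Definition cpd_operator (H : hilbertType R) (T : {linear H -> H}) : Prop :=
  bounded_operator T /\
  forall h : H, cpd_sequence (fun n => complex.Re (`|iter n T h| ^+ 2)).

Lemma wshift_bounded (lam : nat -> R) (lam_bnd : bounded_fun lam) :
  bounded_operator (wshift lam_bnd).
Proof.
have [c c0 cP] := wshift_bound lam_bnd; exists c => f.
rewrite [`|f|]ell2_normE -rmorphM.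
by apply/ell2_norm_leP; [rewrite mulr_ge0 ?sqrtr_ge0|exact: cP].
Qed.

End operators.

Section berger.
Context {R : realType}.
Implicit Types (lam : nat -> R)
  (mu nu : {measure set (measurableTypeR R) -> \bar R}).

Definition lam_hat lam (n : nat) : R := \prod_(k < n) lam k ^+ 2.

(* Borel measures on [0, +oo[ are the Borel measures on R that vanish on
   ]-oo, 0[. *)
Definition has_moments lam mu : Prop :=
  mu `]-oo, (0 : R)[%classic = 0%E /\
  forall n : nat,
    (\int[mu]_(x in `[0%R : R, +oo[) (x ^+ n)%R%:E = (lam_hat lam n)%:E)%E.

Definition berger_measure lam mu : Prop :=
  has_moments lam mu /\
  forall nu, has_moments lam nu -> forall A, measurable A -> nu A = mu A.

End berger.

Lemma hdot_ell2E (R : realType) (f g : ell2 R) : hdot f g = ell2_dot f g.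
Proof. by []. Qed.

(* Main.v *)
From HB Require Import structures.
Require Import Defs.
From mathcomp Require Import all_boot all_order all_algebra.
From mathcomp Require Import all_classical all_reals all_analysis.
From mathcomp Require Import measurable_realfun.
From mathcomp Require Import complex.
From mathcomp Require Import ring lra.

Import Order.TTheory GRing.Theory Num.Theory.
Import numFieldNormedType.Exports.

Local Open Scope classical_set_scope.
Local Open Scope ring_scope.

(** Write [g n] for the squared norm of [W^n e_0], that is [lam_hat lam n], and
[t] for the common squared weight.  The powers [W^n e_j] have squared norms
proportional to [g (j + n)], so conditional positive definiteness makes the
moment functional [L], the linear form on polynomials sending ['X^n] to [g n],
nonnegative on every ['X^j * p ^+ 2] with [p.[1] = 0].  In other words
[q |-> L (('X - 1) ^+ 2 * q)] behaves like integration against a positive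
measure on the half-line.

Five consecutive values of [g] in geometric progression give
[L ('X^kappa * ('X - 1) ^+ 2 * ('X - t) ^+ 2) = 0].  For an honest measure this
would say that it is carried by [0] and [t].  Algebraically, a null square is
orthogonal to everything (Cauchy-Schwarz, [null_square_orthogonal]), and each
use of this lowers the exponent of ['X], until it is one
([null_square_descent]).  Hence [g] satisfies, from index one on, the
linear recurrence with characteristic polynomial
[('X - 1) ^+ 2 * ('X - t)].  From there on, the sequence [g n.+1 - t * g n] is
thus affine; it vanishes twice, hence identically
([geometric_from_one]): all weights but the first are equal, and
[g n = Z * t ^+ n] for [0 < n].  Testing [L] on the square of
[('X - 1) * ('X - t)] leaves only the mass at [0] and yields [Z <= 1]
([geometric_factor_le1]).

Such a shift is dilated to a multiple of a bilateral shift plus a zero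
summand: [e_0] is sent to [sqrt (1 - Z)] times a vector in the kernel plus
[sqrt Z] times the zeroth vector of the bilateral basis ([two_step_shift_subnormal]).

The moments [g] are those of the two-atom measure by direct integration.  For
uniqueness, the moments of order one to three show that [x * (x - t) ^+ 2]
has integral [0], so any representing measure is carried by [0] and [t], and
its first two moments then give the masses ([two_atoms_unique]). *)

Set Implicit Arguments.
Unset Strict Implicit.
Unset Printing Implicit Defensive.

(** * The moment functional of a sequence *)

Definition moment_functional {R : nzRingType} (g : nat -> R) (p : {poly R}) : R :=
  \sum_(i < size p) p`_i * g i.

Lemma moment_functional_widen {R : nzRingType} (g : nat -> R) (p : {poly R}) N :
  (size p <= N)%N -> moment_functional g p = \sum_(i < N) p`_i * g i.
Proof.
move=> pN; rewrite /moment_functional (big_ord_widen N (fun i => p`_i * g i))//.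
rewrite big_mkcond; apply: eq_bigr => i _; case: ltnP => // pi.
by rewrite nth_default// mul0r.
Qed.

Lemma moment_functional_is_linear {R : nzRingType} (g : nat -> R) :
  scalar (moment_functional g).
Proof.
move=> a p q; set N := maxn (size (a *: p + q)) (maxn (size p) (size q)).
rewrite !(@moment_functional_widen _ g _ N) ?leq_max ?leqnn ?orbT//.
rewrite mulr_sumr -big_split; apply: eq_bigr => i _ /=.
by rewrite coefD coefZ mulrDl mulrA.
Qed.

HB.instance Definition _ (R : nzRingType) (g : nat -> R) :=
  GRing.isLinear.Build R {poly R} R *%R (moment_functional g)
    (moment_functional_is_linear g).

Lemma moment_functionalXn {R : nzRingType} (g : nat -> R) n :
  moment_functional g 'X^n = g n.
Proof.
rewrite /moment_functional size_polyXn big_ord_recr/= coefXn eqxx mul1r.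
by rewrite big1 ?add0r// => i _; rewrite coefXn ltn_eqF// mul0r.
Qed.

Lemma moment_functionalD {R : nzRingType} (g : nat -> R) p q :
  moment_functional g (p + q) = moment_functional g p + moment_functional g q.
Proof. exact: linearD. Qed.

Lemma moment_functionalB {R : nzRingType} (g : nat -> R) p q :
  moment_functional g (p - q) = moment_functional g p - moment_functional g q.
Proof. exact: linearB. Qed.

Lemma moment_functionalZ {R : nzRingType} (g : nat -> R) a p :
  moment_functional g (a *: p) = a * moment_functional g p.
Proof. exact: linearZ. Qed.

(** * Null squares of positive functionals *)

(** The discriminant argument of Cauchy-Schwarz: [L (w * (a *: r + q) ^+ 2)] is
affine in [a] once its quadratic coefficient vanishes, and an affine function
bounded below is constant. *)
Lemma null_square_orthogonal {R : realFieldType} (L : {scalar {poly R}})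
    (w r q : {poly R}) :
  (forall p, 0 <= L (w * p ^+ 2)) -> L (w * r ^+ 2) = 0 -> L (w * (r * q)) = 0.
Proof.
move=> L_ge0 Lr0.
have {}L_ge0 a : 0 <= 2 * a * L (w * (r * q)) + L (w * q ^+ 2).
  have := L_ge0 (a *: r + q).
  have -> : w * (a *: r + q) ^+ 2 = (a ^+ 2) *: (w * r ^+ 2)
     + (2 * a) *: (w * (r * q)) + w * q ^+ 2.
    by rewrite -!mul_polyC expr2 !rmorphM rmorph_nat /=; ring.
  by rewrite !linearD !linearZ /= Lr0 mulr0 add0r.
apply/eqP/negPn/negP => Lrq0.
(* this value of a makes the affine expression equal to -1 *)
have := L_ge0 (- (L (w * q ^+ 2) + 1) / (2 * L (w * (r * q)))).
by rewrite (_ : 2 * _ * _ = - (L (w * q ^+ 2) + 1)); [lra|field].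
Qed.

(** Up to the weight [w], read ['X^(k.+2) * r ^+ 2] as
['X^k * ('X * r) ^+ 2]: this null square, tested against [r], makes
['X^(k.+1) * r ^+ 2] null as well.  The descent stops at ['X], because
['X * r ^+ 2] is not [('X * r) ^+ 2] times a power of ['X]; this is why a mass
at the origin can survive. *)
Lemma null_square_descent {R : realFieldType} (L : {scalar {poly R}}) k
    (w r q : {poly R}) :
  (forall j p, 0 <= L ('X^j * w * p ^+ 2)) -> L ('X^(k.+1) * w * r ^+ 2) = 0 ->
  L ('X * w * (r * q)) = 0.
Proof.
move=> L_ge0; elim: k q => [|k IH] q Lr0.
  by apply: null_square_orthogonal => // p; exact: (L_ge0 1%N).
apply: IH.
rewrite (_ : 'X^(k.+1) * _ * _ = 'X^k * w * (('X * r) * r)); last by rewrite exprS; ring.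
apply: null_square_orthogonal => //.
by rewrite (_ : _ * _ = ('X^(k.+2)) * w * r ^+ 2)// !exprS; ring.
Qed.

(** * Rigidity of conditionally positive definite moments *)

Lemma second_difference0_eq0 {R : zmodType} (u : nat -> R) k :
  (forall n, u n.+2 - u n.+1 = u n.+1 - u n) -> u k = 0 -> u k.+1 = 0 ->
  forall n, u n = 0.
Proof.
move=> uD uk0 uk1.
have cst n : u n.+1 - u n = u 1%N - u 0%N by elim: n => // n <-; rewrite uD.
have {}cst n : u n.+1 = u n.
  by apply/eqP; rewrite -subr_eq0 cst -(cst k) uk0 uk1 subrr.
have u0 n : u n = u 0%N by elim: n => // n <-; exact: cst.
by move=> n; rewrite u0 -(u0 k).
Qed.

Lemma moment_functional_geometric {R : comNzRingType} (g : nat -> R) (t : R) k N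
    (p : {poly R}) : (size p <= N.+1)%N ->
  (forall j, (j <= N)%N -> g (k + j)%N = g k * t ^+ j) ->
  moment_functional g ('X^k * p) = g k * p.[t].
Proof.
move=> pN gE; rewrite -{1}[p]coefK poly_def mulr_sumr linear_sum /=.
rewrite horner_coef mulr_sumr; apply: eq_bigr => i _.
rewrite -scalerAr -exprD linearZ /= moment_functionalXn gE; last first.
  by rewrite -ltnS (leq_trans _ pN).
by rewrite mulrCA.
Qed.

(** The first hypothesis is conditional positive definiteness of all the shifts
of [g]; the vanishing of [p] at [1] encodes that its coefficients sum to zero.
With [u n = g n.+2 - t * g n.+1], the vanishing of [L] on
['X * ('X - 1) ^+ 2 * ('X - t) * 'X^n] says that the second difference of [u]
vanishes at [n], and the geometric block provides two consecutive zeros. *)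
Lemma geometric_from_one {R : realFieldType} (g : nat -> R) (t : R) k :
  (forall j p, p.[1] = 0 -> 0 <= moment_functional g ('X^j * p ^+ 2)) ->
  (forall j, (j <= 4)%N -> g (k.+1 + j)%N = g k.+1 * t ^+ j) ->
  forall n, g n.+2 = t * g n.+1.
Proof.
move=> g_cpd gE.
pose w := ('X - 1%:P) ^+ 2 : {poly R}; pose r := 'X - t%:P : {poly R}.
have L_ge0 j p : 0 <= moment_functional g ('X^j * w * p ^+ 2).
  rewrite (_ : _ * _ = 'X^j * (('X - 1%:P) * p) ^+ 2); last by rewrite /w; ring.
  by apply: g_cpd; rewrite hornerM !hornerE subrr mul0r.
have L0 : moment_functional g ('X^(k.+1) * w * r ^+ 2) = 0.
  rewrite -mulrA (@moment_functional_geometric _ _ t _ 4)//.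
    by rewrite hornerM [(r ^+ 2).[t]]horner_exp hornerXsubC subrr expr0n !mulr0.
  rewrite /w /r -exprMn (leq_trans (size_polyMleq _ _))//.
  by rewrite size_mul ?polyXsubC_eq0// !size_XsubC.
pose u n := g n.+2 - t * g n.+1.
have uD n : u n.+2 - u n.+1 = u n.+1 - u n.
  have := null_square_descent 'X^n L_ge0 L0.
  rewrite (_ : _ * _ = 'X^(n.+4) - (2 + t) *: 'X^(n.+3) + (1 + 2 * t) *: 'X^(n.+2)
           - t *: 'X^(n.+1)).
    rewrite /= !(moment_functionalB, moment_functionalD, moment_functionalZ).
    rewrite !moment_functionalXn /u => H.
    by apply/eqP; rewrite -subr_eq0 -[X in _ == X]H; apply/eqP; ring.
  rewrite /w /r -!mul_polyC !rmorphD !rmorphM !rmorph_nat /= !exprS.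
  by rewrite (_ : 1%:P = 1)//; ring.
move=> n; have u0 : u n = 0.
  have h0 := gE 0%N isT; have h1 := gE 1%N isT; have h2 := gE 2%N isT.
  rewrite !addnS addn0 in h1 h2.
  move: n; apply: (second_difference0_eq0 (k := k) uD); rewrite /u.
    by rewrite h1 expr1 mulrC subrr.
  by rewrite h2 h1; ring.
by apply/eqP; rewrite -subr_eq0; apply/eqP.
Qed.

(** Here [L] is [c] times evaluation at [t] plus [1 - c] times evaluation at
[0]; the square below vanishes at [t] and takes the value [t ^+ 2] at [0]. *)
Lemma geometric_factor_le1 {R : realFieldType} (g : nat -> R) (c t : R) :
  (forall j p, p.[1] = 0 -> 0 <= moment_functional g ('X^j * p ^+ 2)) ->
  g 0%N = 1 -> t != 0 -> (forall n, g n.+1 = c * t ^+ n.+1) -> c <= 1.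
Proof.
move=> g_cpd g0 t0 gE.
have := g_cpd 0%N (('X - 1%:P) * ('X - t%:P)).
rewrite !hornerE subrr mul0r => /(_ erefl).
rewrite (_ : _ ^+ 2 = 'X^4 - (2 * (1 + t)) *: 'X^3 + ((1 + t) ^+ 2 + 2 * t) *: 'X^2
    - (2 * t * (1 + t)) *: 'X^1 + t ^+ 2 *: 'X^0); last first.
  rewrite -!mul_polyC !(rmorphD, rmorphM, rmorph_nat, rmorphXn) /= !exprS.
  by rewrite (_ : 1%:P = 1)//; ring.
rewrite /= !(moment_functionalB, moment_functionalD, moment_functionalZ).
rewrite !moment_functionalXn g0 !gE.
rewrite (_ : _ + _ = (1 - c) * t ^+ 2); last by ring.
by rewrite pmulr_lge0 ?subr_ge0// exprn_even_gt0.
Qed.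

(** Bridge from the definition by sums: real coefficients of a polynomial
vanishing at [1] are admissible test vectors.  The factor [c] accounts for
[gamma] being a shift of [g] up to normalization. *)
Lemma cpd_sequence_moment_functional {R : realType} (gamma g : nat -> R) c j :
  cpd_sequence gamma -> 0 < c -> (forall n, g (n + j)%N = c * gamma n) ->
  forall p, p.[1] = 0 -> 0 <= moment_functional g ('X^j * p ^+ 2).
Proof.
move=> gamma_cpd c0 gE p p1.
have [->|p0] := eqVneq p 0; first by rewrite expr0n mulr0 linear0.
set k := (size p).-1.
have sp : size p = k.+1 by rewrite prednK// size_poly_gt0.
have := gamma_cpd k (fun i => (p`_i)%:C%C).
rewrite -rmorph_sum /=.
have -> : \sum_(i < k.+1) p`_i = 0.
  rewrite -[RHS]p1 horner_coef sp; apply: eq_bigr => i _.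
  by rewrite expr1n mulr1.
move=> /(_ erefl).
have -> : \sum_(i < k.+1) \sum_(l < k.+1) (gamma (i + l)%N)%:C%C * (p`_i)%:C%C *
      Num.conj (p`_l)%:C%C =
    (\sum_(i < k.+1) \sum_(l < k.+1) gamma (i + l)%N * p`_i * p`_l)%:C%C.
  rewrite rmorph_sum; apply: eq_bigr => i _; rewrite rmorph_sum.
  apply: eq_bigr => l _; rewrite !rmorphM /=; congr (_ * _); exact: conjc_real.
rewrite lecR => H.
suff -> : moment_functional g ('X^j * p ^+ 2) =
   c * \sum_(i < k.+1) \sum_(l < k.+1) gamma (i + l)%N * p`_i * p`_l.
  by rewrite mulr_ge0// ltW.
rewrite -[p in LHS]coefK poly_def sp expr2 !mulr_sumr linear_sum.
apply: eq_bigr => i _ /=; rewrite mulr_suml mulr_sumr linear_sum mulr_sumr.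
apply: eq_bigr => l _ /=; rewrite -!scalerAr -scalerAl !linearZ /= -scalerAr linearZ /= -!exprD.
by rewrite moment_functionalXn addnC gE (addnC (l : nat)) /GRing.scale /=; ring.
Qed.

(** * Isometries and coordinate operators on square-summable sequences *)

Lemma pair_series {V : nmodType} (a b : nat -> V) M :
  (forall k, a k.*2 + a k.*2.+1 = b k) ->
  \sum_(0 <= n < M.*2) a n = \sum_(0 <= k < M) b k.
Proof.
move=> ab; elim: M => [|M IH]; first by rewrite !big_geq.
by rewrite doubleS !big_nat_recr//= IH -addrA ab.
Qed.

Section ell2_operators.
Context {R : realType}.

Lemma ell2_norm_le (f h : ell2 R) :
  (forall N, exists M, series (fun n => normc (f n) ^+ 2) N
     <= series (fun n => normc (h n) ^+ 2) M) -> `|f| <= `|h|.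
Proof.
move=> fh; rewrite [`|h|]ell2_normE; apply/ell2_norm_leP; first exact: sqrtr_ge0.
move=> N; rewrite sqr_sqrtr ?ell2_lim_ge0//.
by have [M] := fh N; move/le_trans; apply; exact: ell2_lim_ge.
Qed.

(** Polarization: expanding the norms of [x + y] and of ['i *: x + y] recovers
the symmetric and the skew part of the inner product. *)
Lemma isometry_hdot (H K : hilbertType R) (T : {linear H -> K}) :
  (forall x, `|T x| = `|x|) -> forall x y, hdot (T x) (T y) = hdot x y.
Proof.
move=> T_norm.
have sym x y : hdot (T x) (T y) + hdot (T y) (T x) = hdot x y + hdot y x.
  have := sqr_hnormE (T (x + y)); rewrite T_norm sqr_hnormE.
  rewrite linearD !linearDl !linearDr /= -!sqr_hnormE !T_norm.
  move=> E; apply: (addrI (`|x| ^+ 2)); apply: (addIr (`|y| ^+ 2)).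
  by rewrite !addrA in E *.
move=> x y.
have /= := sym ('i *: x) y.
rewrite !linearZ !linearZl_LR /=.
rewrite conjCi !mulNr -!mulrBr => /(mulfI (neq0Ci _)) skew.
have := sym x y; move: skew.
move: (hdot (T x) (T y)) (hdot (T y) (T x)) (hdot x y) (hdot y x) => a b c d.
move=> ab ab'; apply: (@mulfI _ 2); first by rewrite pnatr_eq0.
rewrite (_ : 2 * a = (a - b) + (a + b)); last by ring.
by rewrite ab ab'; ring.
Qed.

Lemma ell2_pred_dominated (f : nat -> R[i]) (h : ell2 R) :
  (forall N, exists M, series (fun n => normc (f n) ^+ 2) N
     <= series (fun n => normc (h n) ^+ 2) M) -> f \in @ell2_pred R.
Proof.
move=> fh; apply/asboolP.
apply: (square_summableP (M := limn (series (fun n => normc (h n) ^+ 2)))) => N.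
by have [M] := fh N; move/le_trans; apply; exact: ell2_lim_ge.
Qed.

Lemma injective_partial_sum (u : nat -> R) (sg : nat -> nat) N :
  injective sg -> (forall n, 0 <= u n) ->
  exists M, series (u \o sg) N <= series u M.
Proof.
move=> sgI u0; exists (\max_(n < N) sg n).+1; rewrite !seriesE.
set M := (X in index_iota 0 X.+1); set s := map sg (index_iota 0 N).
have sM : perm_eq [seq m <- index_iota 0 M.+1 | m \in s] s.
  apply: uniq_perm; first by rewrite filter_uniq// iota_uniq.
    by rewrite map_inj_uniq// iota_uniq.
  move=> m; rewrite mem_filter; case: (boolP (m \in s)) => //= /mapP[n nN ->].
  move: nN; rewrite !mem_index_iota /= ltnS => nN.
  by rewrite (leq_bigmax (F := fun n : 'I_N => sg n) (Ordinal nN)).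
rewrite -(big_map sg xpredT u) -/s -(perm_big _ sM) big_filter.
rewrite [leRHS](bigID (mem s)) /=.
by rewrite lerDl sumr_ge0.
Qed.

Lemma ell2_reindex_subproof (sg : nat -> nat) (sgI : injective sg) (f : ell2 R) :
  (fun n => f (sg n)) \in @ell2_pred R.
Proof.
apply: (ell2_pred_dominated (h := f)) => N.
apply: (injective_partial_sum (u := fun n => normc (f n) ^+ 2)) => // n.
exact: sqr_ge0.
Qed.

Definition ell2_reindex sg (sgI : injective sg) (f : ell2 R) : ell2 R :=
  Ell2 (ell2_reindex_subproof sgI f).

Lemma ell2_reindex_is_linear sg (sgI : injective sg) : linear (ell2_reindex sgI).
Proof. by move=> a f g; apply/val_inj/funext. Qed.

HB.instance Definition _ sg (sgI : injective sg) :=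
  GRing.isLinear.Build R[i] (ell2 R) (ell2 R) _ (ell2_reindex sgI)
    (ell2_reindex_is_linear sgI).

Lemma ell2_reindexK sg tau (sgI : injective sg) (tauI : injective tau) :
  cancel tau sg -> cancel (ell2_reindex sgI) (ell2_reindex tauI).
Proof. by move=> tauK f; apply/val_inj/funext => n /=; rewrite tauK. Qed.

(** Reindexing along an injection does not increase the norm, and here the
inverse operator is again a reindexing. *)
Lemma ell2_reindex_norm sg tau (sgI : injective sg) : cancel tau sg ->
  forall f, `|ell2_reindex sgI f| = `|f|.
Proof.
move=> tauK f; have tauI := can_inj tauK.
have le rho (rhoI : injective rho) h : `|ell2_reindex rhoI h| <= `|h|.
  apply: ell2_norm_le => N.
  apply: (injective_partial_sum (u := fun n => normc (h n) ^+ 2)) => // n.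
  exact: sqr_ge0.
by apply/le_anti; rewrite le/= -{1}(ell2_reindexK sgI tauI tauK f) le.
Qed.

Lemma ell2_reindex_adjoint sg tau (sgI : injective sg) (tauI : injective tau) :
  cancel tau sg -> cancel sg tau ->
  is_adjoint (ell2_reindex sgI) (ell2_reindex tauI).
Proof.
move=> tauK sgK f g; rewrite -[g in LHS](ell2_reindexK tauI sgI sgK).
apply: (isometry_hdot (T := ell2_reindex sgI)); exact: ell2_reindex_norm.
Qed.

Lemma ell2_kill0_subproof (f : ell2 R) :
  (fun n => if n is 0%N then 0 else f n) \in @ell2_pred R.
Proof.
apply: (ell2_pred_dominated (h := f)) => N; exists N; apply: ler_sum => -[|n] _ //.
rewrite -[X in normc X ^+ 2 <= _]/(0 : R[i]) ComplexField.Normc.normc0 expr0n.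
exact: sqr_ge0.
Qed.

Definition ell2_kill0 (f : ell2 R) : ell2 R := Ell2 (ell2_kill0_subproof f).

Lemma ell2_kill0_is_linear : linear ell2_kill0.
Proof.
move=> a f g; apply/val_inj/funext => -[|n] //=.
by rewrite -[RHS]/(a * 0 + 0) mulr0 addr0.
Qed.

HB.instance Definition _ :=
  GRing.isLinear.Build R[i] (ell2 R) (ell2 R) _ ell2_kill0 ell2_kill0_is_linear.

Lemma ell2_kill0_norm f : `|ell2_kill0 f| <= `|f|.
Proof.
apply: ell2_norm_le => N; exists N; apply: ler_sum => -[|n] _ //.
rewrite -[X in normc X ^+ 2 <= _]/(0 : R[i]) ComplexField.Normc.normc0 expr0n.
exact: sqr_ge0.
Qed.

Lemma ell2_kill0_selfadjoint : is_adjoint ell2_kill0 ell2_kill0.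
Proof.
move=> f g; rewrite !hdot_ell2E; congr csum; apply/funext => -[|n] //=.
by rewrite mul0r rmorph0 mulr0.
Qed.

Lemma ell2_kill0_reindex sg (sgI : injective sg) f : sg 0%N = 0%N ->
  ell2_reindex sgI (ell2_kill0 f) = ell2_kill0 (ell2_reindex sgI f).
Proof.
move=> sg0; apply/val_inj/funext => -[|n] /=; first by rewrite sg0.
case E: (sg n.+1) => [|m]; last by rewrite -E.
by move: E; rewrite -sg0 => /sgI.
Qed.


(** * A normal extension of a shift with constant weights after the first *)

(** The isometry into the dilation space.  There index [0] is the kernel vector
and index [k.*2.+1] the vector of number [k] of a bilateral basis, so [e_0]
is split between indices [0] and [1] while [e_k] goes to [k.*2.+1].  Positive
even indices hold the negative half of the bilateral basis and receive
nothing.  Each pair [k.*2], [k.*2.+1] thus depends on the coordinate [k] only,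
whence the halving in [fork_fun]. *)
Definition fork_coef (z : R) (n : nat) : R :=
  match n with 0%N => Num.sqrt (1 - z) | 1%N => Num.sqrt z | _ => (odd n)%:R end.

Definition fork_fun (z : R) (f : nat -> R[i]) (n : nat) : R[i] :=
  (fork_coef z n)%:C%C * f n./2.

Lemma sqr_normc_real (r : R) : normc r%:C%C ^+ 2 = r ^+ 2.
Proof. by rewrite sqr_normcE /= expr0n addr0. Qed.

Lemma fork_partial_sum z (f : nat -> R[i]) M : 0 <= z <= 1 ->
  series (fun n => normc (fork_fun z f n) ^+ 2) M.*2 =
  series (fun n => normc (f n) ^+ 2) M.
Proof.
move=> /andP[z0 z1]; apply: pair_series => k.
rewrite /fork_fun !ComplexField.Normc.normcM !exprMn /= uphalf_double doubleK -mulrDl.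
rewrite !sqr_normc_real.
case: k => [|k]; first by rewrite /= !sqr_sqrtr ?subr_ge0// subrK mul1r.
rewrite /= odd_double /=.
by rewrite expr0n expr1n add0r mul1r.
Qed.

Lemma fork_subproof z (f : ell2 R) : 0 <= z <= 1 -> fork_fun z f \in @ell2_pred R.
Proof.
move=> z01; apply: (ell2_pred_dominated (h := f)) => N; exists N.
rewrite -(fork_partial_sum f N z01).
apply: (nondecreasing_series (P := xpredT)) => [n _ _|]; first exact: sqr_ge0.
by rewrite -addnn leq_addr.
Qed.

Definition fork z (z01 : 0 <= z <= 1) (f : ell2 R) : ell2 R := Ell2 (fork_subproof f z01).

Lemma fork_is_linear z (z01 : 0 <= z <= 1) : linear (fork z01).
Proof.
move=> a f g; apply/val_inj/funext => n /=.
rewrite -[RHS]/(a * fork_fun z f n + fork_fun z g n).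
by rewrite /fork_fun -[X in _ * X]/(a * f n./2 + g n./2); ring.
Qed.

HB.instance Definition _ z (z01 : 0 <= z <= 1) :=
  GRing.isLinear.Build R[i] (ell2 R) (ell2 R) _ (fork z01) (fork_is_linear z01).

Lemma fork_norm z (z01 : 0 <= z <= 1) f : `|fork z01 f| = `|f|.
Proof.
apply/le_anti/andP; split; apply: ell2_norm_le => N.
  exists N; rewrite -(fork_partial_sum f N z01).
  apply: (nondecreasing_series (P := xpredT)) => [n _ _|]; first exact: sqr_ge0.
  by rewrite -addnn leq_addr.
by exists N.*2; rewrite fork_partial_sum.
Qed.

(** The bilateral shift on indices: along the line of the even indices in
decreasing order followed by the odd ones in increasing order
(... 6, 4, 2, 1, 3, 5 ...), [forth] moves one step to the right and [back] one
step to the left; both fix [0]. *)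
Definition back (n : nat) : nat :=
  match n with
  | 0 => 0 | 1 => 2 | m.+2 => if odd m then m else m.+4 end.

Definition forth (n : nat) : nat :=
  match n with
  | 0 => 0 | 1 => 3 | 2 => 1 | m.+2 => if odd m then m.+4 else m end.

Lemma forthK : cancel forth back.
Proof.
move=> [|[|[|n]]] //=; case: ifP => /= nn; first by rewrite negbK nn.
by case: n nn => [|n] //=; rewrite negbK => ->.
Qed.

Lemma backK : cancel back forth.
Proof.
move=> [|[|n]] //=; case: ifP => /= nn; last by rewrite negbK nn.
by case: n nn => [|[|[|n]]] //=; rewrite !negbK => ->.
Qed.

Lemma hdotZ_real (H : hilbertType R) (r : R) (x y : H) :
  hdot (r%:C%C *: x) y = hdot x (r%:C%C *: y).
Proof.
by rewrite linearZl_LR linearZr_LR /=; congr (_ * _); exact/esym/conjc_real.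
Qed.

(** The normal operator is [s] times the bilateral shift on the nonzero indices
and zero at index [0]; the weights of the bilateral shift being constant, it
commutes with its adjoint, [s] times the inverse shift. *)
Lemma two_step_shift_subnormal (lam : nat -> R) (lam_bnd : bounded_fun lam) :
  (forall n, 0 < lam n) -> lam 0%N <= lam 1%N ->
  (forall n, lam n.+1 = lam 1%N) -> subnormal (wshift lam_bnd).
Proof.
move=> lam_gt0 lam01 lamE; pose s := lam 1%N; pose z := (lam 0%N / s) ^+ 2.
have z01 : 0 <= z <= 1.
  have r0 : 0 <= lam 0%N / s by rewrite divr_ge0// ltW// lam_gt0.
  have r1 : lam 0%N / s <= 1 by rewrite ler_pdivrMr ?mul1r// lam_gt0.
  by rewrite sqr_ge0/= exprn_ile1.
have backI := can_inj backK; have forthI := can_inj forthK.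
pose N : {linear ell2 R -> ell2 R} :=
  s%:C%C \*: (ell2_kill0 \o ell2_reindex backI).
pose S : {linear ell2 R -> ell2 R} :=
  s%:C%C \*: (ell2_kill0 \o ell2_reindex forthI).
exists (ell2 R), (fork z01), N; split.
- exact/isometry_hdot/fork_norm.
- split.
    exists s => f; rewrite /N /= normrZ -[`|s%:C%C|]/((normc s%:C%C)%:C%C).
    rewrite /= expr0n addr0 sqrtr_sqr gtr0_norm; last exact: lam_gt0.
    apply: ler_wpM2l; first by rewrite ler0c ltW//; exact: lam_gt0.
    by rewrite -(ell2_reindex_norm backI forthK f) ell2_kill0_norm.
  exists S; split.
    move=> f g; rewrite /N /S /= hdotZ_real ell2_kill0_selfadjoint.
    rewrite (ell2_reindex_adjoint _ forthI forthK backK).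
    by rewrite (_ : ell2_reindex _ _ = s%:C%C *: ell2_kill0 (ell2_reindex forthI g))//
      !linearZ /= ell2_kill0_reindex.
  move=> f; rewrite /N /S /= !linearZ /= !ell2_kill0_reindex//.
  by rewrite (ell2_reindexK _ _ backK) (ell2_reindexK _ _ forthK).
move=> f; apply/val_inj/funext => n; rewrite /N /=.
rewrite -[LHS]/(s%:C%C * _).
have fork_odd h m : odd m -> fork_fun z h m.+2 = h (m./2.+1).
  by move=> om; rewrite /fork_fun /= negbK om mul1r.
have fork_even h m : ~~ odd m -> fork_fun z h m.+2 = 0.
  by move=> om; rewrite /fork_fun /= negbK (negPf om) mul0r.
case: n => [|[|n]].
- by rewrite /= /fork_fun !mulr0.
- by rewrite -[LHS]/(s%:C%C * fork_fun z f 2) fork_even// /fork_fun /= !mulr0.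
rewrite -[LHS]/(s%:C%C * fork_fun z f (if odd n then n else n.+4)).
have [on|en] := boolP (odd n); last by rewrite !fork_even ?mulr0//= negbK.
rewrite [RHS]fork_odd//; case: n on => [|[|n]] //= on; last first.
  by rewrite fork_odd ?lamE// -[odd n]negbK.
(* the image of e_0: s * sqrt z = lam 0 *)
rewrite /fork_fun /= mulrA -rmorphM /z sqrtr_sqr gtr0_norm ?divr_gt0 ?lam_gt0//.
by congr (_%:C%C * _); rewrite mulrC divfK// gt_eqF// lam_gt0.
Qed.
End ell2_operators.

(** * Two-atom measures and their moments *)

Section two_atoms.
Context {R : realType}.
Implicit Types (t z : R).

Let D : set R := `[0%R : R, +oo[.

Definition two_atoms (z w t : R) (z0 : 0 <= z) (w0 : 0 <= w) :=
  measure_add (mscale (NngNum w0) (@dirac _ (measurableTypeR R) 0 R))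
    (mscale (NngNum z0) (@dirac _ (measurableTypeR R) t R)).

Lemma measurable_EFinX (A : set R) n :
  measurable_fun A (EFin \o (fun x : R => x ^+ n)).
Proof. by apply/measurable_EFinP; exact: exprn_measurable. Qed.

Lemma moments_two_atoms z w t (z0 : 0 <= z) (w0 : 0 <= w) n : 0 <= t ->
  (\int[two_atoms t z0 w0]_(x in D) (x ^+ n)%R%:E)%E = (w * 0 ^+ n + z * t ^+ n)%:E.
Proof.
move=> t0.
have mD : measurable D by exact: measurable_itv.
have pos (x : R) : D x -> (0 <= (x ^+ n)%:E)%E.
  by rewrite /D /= in_itv/= andbT lee_fin => x0; exact: exprn_ge0.
have dE (a : R) : 0 <= a ->
    (\int[@dirac _ (measurableTypeR R) a R]_(x in D) (x ^+ n)%R%:E)%E = (a ^+ n)%:E.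
  move=> a0; rewrite integral_dirac//; last exact: measurable_EFinX.
  by rewrite diracE mem_set ?mul1e// /D /= in_itv/= a0.
rewrite /two_atoms ge0_integral_measure_add//; last exact: measurable_EFinX.
rewrite !ge0_integral_mscale//; [|exact: measurable_EFinX..].
by rewrite !dE// -!EFinM -EFinD.
Qed.

(** The identity [x * (x - t) ^+ 2 = x ^+ 3 - 2 * t * x ^+ 2 + t ^+ 2 * x] is
integrated with its negative term moved to the other side: all integrands are
then nonnegative and no integrability has to be known.  The factor [x] puts [0] among the zeros
of the integrand. *)
Lemma two_atoms_unique (nu : {measure set (measurableTypeR R) -> \bar R}) z w t :
  0 < t -> nu `]-oo, (0 : R)[%classic = 0%E ->
  (forall n : nat, (n <= 3)%N ->
    (\int[nu]_(x in D) (x ^+ n)%R%:E = (w * 0 ^+ n + z * t ^+ n)%:E)%E) ->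
  forall A : set (measurableTypeR R), measurable A ->
    nu A = (w%:E * dirac (0%R : R) A + z%:E * dirac t A)%E.
Proof.
move=> t0 nu_neg nuE.
have mD : measurable D by exact: measurable_itv.
have m1 (x : R) : measurable ([set x] : set (measurableTypeR R)) by exact: measurable_set1.
have D0 x : D x -> 0 <= x by rewrite /D /= in_itv/= andbT.
pose f x : R := x * (x - t) ^+ 2.
have f0 x : D x -> (0 <= (f x)%:E)%E.
  by move=> /D0 x0; rewrite lee_fin mulr_ge0// sqr_ge0.
have mf : measurable_fun D (EFin \o f).
  apply/measurable_EFinP; apply: measurable_funM => //.
  by apply: measurable_funX; apply: measurable_funB.
have intf : (\int[nu]_(x in D) (f x)%:E = 0)%E.
  have Z n k : 0 <= k -> (n <= 3)%N ->
      (\int[nu]_(x in D) (k%:E * (x ^+ n)%R%:E) = k%:E * (w * 0 ^+ n + z * t ^+ n)%:E)%E.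
    move=> k0 n3; rewrite ge0_integralZl_EFin// ?nuE//; last exact: measurable_EFinX.
    by move=> x /D0 x0; rewrite lee_fin exprn_ge0.
  have E : (\int[nu]_(x in D) ((f x)%:E + (2 * t)%:E * (x ^+ 2)%R%:E)
    = \int[nu]_(x in D) (1%:E * (x ^+ 3)%R%:E + (t ^+ 2)%:E * (x ^+ 1)%R%:E))%E.
    by apply: eq_integral => x _; rewrite -!EFinM -!EFinD /f; congr EFin; ring.
  move: E.
  have mX k n : measurable_fun D (EFin \o (fun x : R => k * x ^+ n)).
    by apply/measurable_EFinP; apply: measurable_funM => //; exact: exprn_measurable.
  have X0 k n x : 0 <= k -> D x -> (0 <= k%:E * (x ^+ n)%R%:E)%E.
    by move=> k0 /D0 x0; rewrite -EFinM lee_fin mulr_ge0// exprn_ge0.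
  have t20 : 0 <= 2 * t by rewrite mulr_ge0// ltW.
  rewrite ge0_integralD//; [|by move=> x; exact: X0|exact: mX].
  rewrite ge0_integralD//;
    [|by move=> x; exact: X0|exact: mX|by move=> x; apply: X0; exact: sqr_ge0|exact: mX].
  rewrite !Z// ?sqr_ge0// -!EFinM -!EFinD.
  case: (\int[nu]_(x in D) (f x)%:E)%E => [r| |] //=.
  rewrite -EFinD => -[E]; congr EFin; move: E; rewrite !expr0n/= => E.
  by apply: (addIr (2 * t * (w * 0 + z * t ^+ 2))); rewrite add0r E; ring.
have nuN : nu (D `\` [set 0; t]) = 0%E.
  have /(ae_eq_integral_abs nu mD mf) [N [mN N0 fN]] : (\int[nu]_(x in D) `|(f x)%:E| = 0)%E.
    by rewrite -[RHS]intf; apply: eq_integral => x /[!inE] Dx; rewrite gee0_abs// f0.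
  apply: (subset_measure0 _ _ _ N0) => //.
    by apply: measurableD => //; exact: measurableU.
  move=> x [Dx x0t]; apply: fN => /= /(_ Dx) [] /eqP.
  rewrite mulf_eq0 sqrf_eq0 subr_eq0 => /orP[] /eqP xE; apply: x0t; [by left|by right].
pose P0 : set (measurableTypeR R) := [set (0 : R)].
pose Pt : set (measurableTypeR R) := [set t].
have P0t : P0 `&` Pt = set0.
  by apply/seteqP; split => // x [/= -> ] /esym/eqP; rewrite (gt_eqF t0).
have mP0 : measurable P0 by exact: m1.
have mPt : measurable Pt by exact: m1.
have nuA A : measurable A -> nu A = (nu (A `&` P0) + nu (A `&` Pt))%E.
  move=> mA; have mAP : measurable (A `&` (P0 `|` Pt)).
    by apply: measurableI => //; exact: measurableU.
  have mAC : measurable (A `\` (P0 `|` Pt)) by apply: measurableD => //; exact: measurableU.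
  rewrite -{1}(setUIDK A (P0 `|` Pt)) measureU0//.
    rewrite setIUr measureU//; [exact: measurableI..|].
    by rewrite setIACA P0t setI0.
  have mN : measurable (D `\` [set 0; t]) by apply: measurableD => //; exact: measurableU.
  have mneg : measurable (`]-oo, (0 : R)[%classic : set R) by exact: measurable_itv.
  apply: (@subset_measure0 _ _ _ nu _ (`]-oo, (0 : R)[%classic `|` (D `\` [set 0; t]))) => //.
  - exact: measurableU.
  - move=> x [_ x0t]; have [x0|x0] := ltP x 0; [left|right].
      by rewrite /= in_itv.
    by split => //; rewrite /D /= in_itv/= x0.
  - by apply: etrans nuN; rewrite setUC; apply: measureU0.
have nuX n : (n <= 3)%N ->
    ((0 ^+ n)%:E * nu P0 + (t ^+ n)%:E * nu Pt = (w * 0 ^+ n + z * t ^+ n)%:E)%E.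
  move=> n3; rewrite -nuE//.
  have DN : D `\` (D `\` [set 0; t]) = P0 `|` Pt.
    rewrite setDD; apply/seteqP; split => x /=; first by case.
    by move=> x0t; split => //; case: x0t => ->; rewrite /D /= in_itv/= ?lexx ?ltW.
  have X0 x : D x -> (0 <= (x ^+ n)%:E)%E by move=> /D0 x0; rewrite lee_fin exprn_ge0.
  have DP x : (P0 `|` Pt) x -> D x by rewrite -DN => -[].
  rewrite (@ge0_negligible_integral _ _ _ nu _ (D `\` [set 0; t]))//.
  + rewrite DN ge0_integral_setU//; last 3 first.
    * exact: measurable_EFinX.
    * by move=> x /DP; exact: X0.
    * by apply/disj_setPS; rewrite P0t.
    have pt a : (\int[nu]_(x in [set a]) (x ^+ n)%:E = (a ^+ n)%:E * nu [set a])%E.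
      by rewrite -integral_cst//; apply: eq_integral => x /[!inE] ->.
    by rewrite !pt.
  + by apply: measurableD => //; exact: measurableU.
  + exact: measurable_EFinX.
have nuPt : nu Pt = z%:E.
  have := nuX 1%N isT; rewrite !expr1 mul0e add0e mulr0 add0r mulrC.
  case: (nu Pt) => [r| |]; [|by rewrite gt0_muley ?lte_fin|by rewrite gt0_muleNy ?lte_fin].
  by rewrite -EFinM => -[/(mulfI (lt0r_neq0 t0)) ->].
have nuP0 : nu P0 = w%:E.
  have := nuX 0%N isT; rewrite !expr0 !mul1e nuPt !mulr1.
  by case: (nu P0) => [r| |]//; rewrite -EFinD => -[/addIr ->].
move=> A mA; rewrite nuA//.
have atom a c : nu [set a] = c%:E -> nu (A `&` [set a]) = (c%:E * \d_a A)%E.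
  move=> nua; rewrite diracE; case: (boolP (a \in A)) => aA.
    by rewrite mule1 -nua; congr (nu _); rewrite setIidr// => x -> ; exact/set_mem.
  rewrite mule0 (_ : _ `&` _ = set0) ?measure0//.
  by apply/seteqP; split => // x [Ax] /= xa; move: aA; rewrite -xa mem_set.
by rewrite (atom _ _ nuP0) (atom _ _ nuPt).
Qed.
End two_atoms.

(** * Weighted shifts *)

Lemma ell2_basis_norm {R : realType} n : `|ell2_basis n : ell2 R| = 1.
Proof.
rewrite ell2_normE (_ : limn _ = 1 :> R) ?sqrtr1//.
apply: lim_near_cst => //; exists n.+1 => // N /= nN; rewrite seriesE.
rewrite (bigD1_seq n) ?mem_index_iota ?iota_uniq//= eqxx.
rewrite ComplexField.Normc.normc1 expr1n big1 ?addr0// => k /negPf ->.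
by rewrite ComplexField.Normc.normc0 expr0n.
Qed.

Lemma iter_wshift_basis {R : realType} (lam : nat -> R) (lam_bnd : bounded_fun lam) k n :
  iter n (wshift lam_bnd) (ell2_basis k) =
  (\prod_(i < n) lam (k + i)%N)%:C%C *: ell2_basis (k + n).
Proof.
elim: n => [|n IH]; first by rewrite big_ord0 addn0 scale1r.
rewrite iterS IH linearZ /= wshift_basis scalerA addnS big_ord_recr /=.
by rewrite -rmorphM.
Qed.

Lemma lam_hatS {R : realType} (lam : nat -> R) n :
  lam_hat lam n.+1 = lam_hat lam n * lam n ^+ 2.
Proof. by rewrite /lam_hat big_ord_recr. Qed.

Lemma lam_hat_gt0 {R : realType} (lam : nat -> R) n :
  (forall n, 0 < lam n) -> 0 < lam_hat lam n.
Proof. by move=> lam_gt0; apply: prodr_gt0 => i _; exact: exprn_gt0. Qed.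

Lemma lam_hatD {R : realType} (lam : nat -> R) k n :
  lam_hat lam (k + n) = lam_hat lam k * (\prod_(i < n) lam (k + i)%N) ^+ 2.
Proof.
elim: n => [|n IH]; first by rewrite addn0 big_ord0 expr1n mulr1.
by rewrite addnS lam_hatS IH big_ord_recr /= exprMn -mulrA.
Qed.

(** Testing conditional positive definiteness on [ell2_basis j] provides the
positivity of the shift of [lam_hat lam] by [j]. *)
Lemma cpd_shift_moment_functional {R : realType} (lam : nat -> R)
    (lam_bnd : bounded_fun lam) :
  (forall n, 0 < lam n) -> cpd_operator (wshift lam_bnd) ->
  forall j p, p.[1] = 0 -> 0 <= moment_functional (lam_hat lam) ('X^j * p ^+ 2).
Proof.
move=> lam_gt0 [_ W_cpd] j p.
apply: (cpd_sequence_moment_functional (W_cpd (ell2_basis j))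
  (lam_hat_gt0 j lam_gt0)) => n.
rewrite addnC lam_hatD iter_wshift_basis normrZ ell2_basis_norm mulr1.
rewrite -sqr_normc_real -[X in complex.Re (X ^+ 2)]/((normc _)%:C%C) -rmorphXn.
by [].
Qed.

Unset Implicit Arguments.

Theorem theorem8p1 (R : realType) (lam : nat -> R)
  (lam_gt0 : forall n : nat, 0 < lam n) (lam_bnd : bounded_fun lam)
  (W_cpd : cpd_operator (wshift lam_bnd))
  (kappa : nat) (kappa_ge1 : (1 <= kappa)%N)
  (lam_kappa1 : lam kappa = lam kappa.+1)
  (lam_kappa2 : lam kappa.+1 = lam kappa.+2)
  (lam_kappa3 : lam kappa.+2 = lam kappa.+3)
  (lam_kappa_neq1 : lam kappa.+3 <> 1) :
  [/\ lam 0%N <= lam 1%N,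
      forall n : nat, (1 <= n)%N -> lam 1%N = lam n,
      subnormal (wshift lam_bnd) &
      exists mu : {measure set (measurableTypeR R) -> \bar R},
        berger_measure lam mu /\
        let Z : R := (lam 0%N / lam 1%N) ^+ 2 in
        forall A : set (measurableTypeR R), measurable A ->
          mu A = ((1 - Z)%R%:E * dirac (0%R : R) A
                  + Z%:E * dirac ((lam 1%N ^+ 2)%R : R) A)%E].
Proof.
have g_cpd := cpd_shift_moment_functional lam_gt0 W_cpd.
case: kappa kappa_ge1 lam_kappa1 lam_kappa2 lam_kappa3 {lam_kappa_neq1} => // k _ e1 e2 e3.
have gE j : (j <= 4)%N ->
    lam_hat lam (k.+1 + j) = lam_hat lam k.+1 * (lam k.+1 ^+ 2) ^+ j.
  elim: j => [|j IH] j4; first by rewrite addn0 mulr1.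
  rewrite addnS lam_hatS IH 1?ltnW// [_ ^+ j.+1]exprSr [RHS]mulrA; congr (_ * _ ^+ 2).
  case: j j4 {IH} => [|[|[|[|j]]]] // _; rewrite ?(addn0, addnS) ?addn0 //; congruence.
have gS := geometric_from_one g_cpd gE.
have lamk n : lam n.+1 = lam k.+1.
  have sq : lam n.+1 ^+ 2 = lam k.+1 ^+ 2.
    apply: (@mulfI _ (lam_hat lam n.+1)); first by rewrite gt_eqF ?lam_hat_gt0.
    by rewrite -lam_hatS gS mulrC.
  by apply/eqP; rewrite -(eqrXn2 (n := 2)) ?sq// ltW.
have lam1 n : lam n.+1 = lam 1%N by rewrite !lamk.
set Z := (lam 0%N / lam 1%N) ^+ 2; pose t := lam 1%N ^+ 2.
have t0 : 0 < t by exact: exprn_gt0.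
have g0 : lam_hat lam 0 = 1 by rewrite /lam_hat big_ord0.
have gZ n : lam_hat lam n.+1 = Z * t ^+ n.+1.
  elim: n => [|n IH]; last by rewrite gS IH -(lamk 0%N) -/t [t ^+ n.+2]exprS mulrCA.
  by rewrite lam_hatS g0 mul1r expr1 /Z /t expr_div_n divfK// gt_eqF.
have Z1 : Z <= 1 by exact: (geometric_factor_le1 g_cpd g0 (lt0r_neq0 t0) gZ).
have lam01 : lam 0%N <= lam 1%N.
  have r0 : 0 <= lam 0%N / lam 1%N by rewrite divr_ge0// ltW.
  by rewrite -[leRHS]mul1r -ler_pdivrMr// -(ler_pXn2r (n := 2)) ?expr1n ?nnegrE.
have Z0 : 0 <= Z by exact: sqr_ge0.
have W0 : 0 <= 1 - Z by rewrite subr_ge0.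
have momE n : lam_hat lam n = (1 - Z) * 0 ^+ n + Z * t ^+ n.
  by case: n => [|n]; rewrite ?g0 ?gZ ?expr0 ?expr0n/=; ring.
split => //.
- by case=> // n _; rewrite lam1.
- exact: two_step_shift_subnormal.
have muE (A : set (measurableTypeR R)) : two_atoms t Z0 W0 A =
    ((1 - Z)%R%:E * dirac (0%R : R) A + Z%:E * dirac t A)%E.
  by rewrite /two_atoms measure_addE.
have mu_neg : two_atoms t Z0 W0 `]-oo, (0 : R)[%classic = 0%E.
  rewrite muE !diracE !memNset ?mule0 ?adde0//= in_itv/= ?ltxx//.
  by apply/negP; rewrite -leNgt ltW.
exists (two_atoms t Z0 W0); split; last by move=> ? ? _; exact: muE.
split=> [|nu [nu_neg nu_mom] A mA].
  split=> // n; rewrite momE; apply: moments_two_atoms; exact: ltW.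
apply: etrans (esym (muE A)); apply: two_atoms_unique => // n _.
by rewrite nu_mom momE.
Qed.
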